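(* The pure liquid price of anarchy of the simultaneous first price auction (SFPA), and that of the simultaneous second price auction (SSPA), over games in which all players have (monotone) subadditive valuation functions, are each at most $2$. That is, for either auction, every $n$, $m$, all monotone subadditive valuations $v_1,\dots,v_n$, all budgets $c_1,\dots,c_n\ge 0$, every pure Nash equilibrium $\mathbf{b}$ of the induced game (with conservative players) and every allocation $\mathbf{Y}$, $\mathrm{LW}(\mathbf{Y})\le 2\,\mathrm{LW}(\mathbf{X}(\mathbf{b}))$.
   Context: Setting: $m$ items are allocated to $n$ players. Player $i$ has a valuation function $v_i:2^{[m]}\to\mathbb{R}_{\ge 0}$ and a private budget $c_i\in\mathbb{R}_{\ge 0}$. A valuation $v_i$ is monotone if $S\subseteq T$ implies $v_i(S)\le v_i(T)$, and subadditive if $v_i(S\cup T)\le v_i(S)+v_i(T)$ for all $S,T\subseteq[m]$. All valuations are assumed monotone and subadditive. Auctions: each player $i$ submits bids $\mathbf{b}_i=(b_{ij})_{j\in[m]}$, $b_{ij}\ge 0$; $\mathbf{b}=(\mathbf{b}_i)_{i\in[n]}$ and $\mathbf{b}_{[j]}=(b_{ij})_{i\in[n]}$. Each item $j$ is allocated independently to a player with the highest bid for it (ties are broken arbitrarily), who pays $p_j(\mathbf{b}_{[j]})$. In SFPA the winner of item $j$ pays her own bid for $j$; in SSPA she pays the second highest bid for $j$. $\mathbf{X}(\mathbf{b})=(X_1,\dots,X_n)$ denotes the resulting allocation, a partition of $[m]$. Utility: $u_i(\mathbf{b})=v_i(X_i)-\sum_{j\in X_i}p_j(\mathbf{b}_{[j]})$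 if player $i$'s total payment does not exceed $c_i$, and $-\infty$ otherwise. A bid matrix $\mathbf{b}$ is a pure Nash equilibrium if $u_i(\mathbf{b})\ge u_i(\mathbf{y},\mathbf{b}_{-i})$ for every player $i$ and every bid vector $\mathbf{y}$, where $(\mathbf{y},\mathbf{b}_{-i})$ is $\mathbf{b}$ with $\mathbf{b}_i$ replaced by $\mathbf{y}$. $\mathrm{EQ}(\mathcal{G})$ is the set of equilibria of the game $\mathcal{G}$. Conservative behavior (standing assumption): the sum of bids a player submits for a bundle of items exceeds neither her value for this bundle nor her budget, that is, $\sum_{j\in X_i}b_{ij}\le\min\{v_i(X_i),c_i\}$. Liquid welfare: for an allocation $\mathbf{X}$ (a partition of $[m]$ among the players), $\mathrm{LW}(\mathbf{X})=\sum_{i\in[n]}\min\{v_i(X_i),c_i\}$. The pure liquid price of anarchy of an auction is $\mathrm{LPoA}=\sup_{\mathcal{G}}\frac{\max_{\mathbf{Y}}\mathrm{LW}(\mathbf{Y})}{\min_{\mathbf{b}\in\mathrm{EQ}(\mathcal{G})}\mathrm{LW}(\mathbf{X}(\mathbf{b}))}$, the supremum being over all games induced by the auction. *)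

(* Defs.v *)
From mathcomp Require Import all_boot all_order all_algebra.
From mathcomp Require Import all_classical all_reals ereal.

Set Implicit Arguments.
Unset Strict Implicit.
Unset Printing Implicit Defensive.

Import Order.TTheory GRing.Theory Num.Theory.
Local Open Scope ring_scope.

Variant auction := SFPA | SSPA.

(* [payment a bj w] is what the winner [w] of an item pays when the bids for
   it are [bj].  Second highest is meant with multiplicity (it equals the
   highest bid in case of a tie for it), and is 0 when there is one bidder. *)
Definition payment (R : realType) (a : auction) (n : nat) (bj : 'cV[R]_n)
    (w : 'I_n) : R :=
  match a with
  | SFPA => bj w 0
  | SSPA => nth 0 (sort >=%R [seq bj k 0 | k : 'I_n]) 1
  end.

(* Ties are broken by an arbitrary fixed rule, which may depend on the item and
   on all the bids for it: [winner j bj] gets item [j] under the bids [bj]. *)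
Record game (R : realType) := Game {
  players : nat;
  items : nat;
  valuation : 'I_players -> {set 'I_items} -> R;
  budget : 'I_players -> R;
  winner : 'I_items -> 'cV[R]_players -> 'I_players;
  valuation_ge0 : forall i S, 0 <= valuation i S;
  budget_ge0 : forall i, 0 <= budget i;
  winner_highest : forall j (bj : 'cV[R]_players) k,
    bj k 0 <= bj (winner j bj) 0
}.

Definition monotone_valuation (R : realType) (m : nat)
    (v : {set 'I_m} -> R) : Prop :=
  forall S T : {set 'I_m}, S \subset T -> v S <= v T.

Definition subadditive_valuation (R : realType) (m : nat)
    (v : {set 'I_m} -> R) : Prop :=
  forall S T : {set 'I_m}, v (S :|: T) <= v S + v T.

Definition subadditive_games (R : realType) : set (game R) :=
  [set G | forall i, monotone_valuation (@valuation R G i) /\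
                     subadditive_valuation (@valuation R G i)]%classic.

Section Game.
Variables (R : realType) (a : auction) (G : game R).
Local Notation n := (players G).
Local Notation m := (items G).

(* Bundles may be empty, unlike the blocks of [finset.partition]. *)
Definition is_allocation (X : {ffun 'I_n -> {set 'I_m}}) : Prop :=
  (forall i k, i != k -> [disjoint X i & X k]) /\
  \bigcup_i X i = [set: 'I_m].

Definition liquid_welfare (X : {ffun 'I_n -> {set 'I_m}}) : R :=
  \sum_(i < n) Num.min (valuation i (X i)) (budget i).

(* Row [i] of a bid matrix holds the bids of player [i], and column [j] the
   bids for item [j]. *)
Definition outcome (b : 'M[R]_(n, m)) : {ffun 'I_n -> {set 'I_m}} :=
  [ffun i => [set j | winner j (col j b) == i]].

Definition total_payment (b : 'M[R]_(n, m)) (i : 'I_n) : R :=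
  \sum_(j in outcome b i) payment a (col j b) i.

Definition utility (b : 'M[R]_(n, m)) (i : 'I_n) : \bar R :=
  if total_payment b i <= budget i
  then (valuation i (outcome b i) - total_payment b i)%:E
  else -oo%E.

Definition deviate (b : 'M[R]_(n, m)) (i : 'I_n) (y : 'rV[R]_m) :
    'M[R]_(n, m) :=
  \matrix_(k, j) if k == i then y 0 j else b k j.

Definition pure_nash (b : 'M[R]_(n, m)) : Prop :=
  forall (i : 'I_n) (y : 'rV[R]_m), (forall j, 0 <= y 0 j) ->
    (utility (deviate b i y) i <= utility b i)%E.

Definition conservative (b : 'M[R]_(n, m)) : Prop :=
  forall i : 'I_n, \sum_(j in outcome b i) b i j <=
    Num.min (valuation i (outcome b i)) (budget i).

Definition EQ : set 'M[R]_(n, m) :=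
  [set b : 'M[R]_(n, m) |
    [/\ forall i j, 0 <= b i j, conservative b & pure_nash b]]%classic.

(* In [\bar R], 0^-1 = +oo, +oo^-1 = 0 and 0 * +oo = 0.  So the ratio is +oo if
   only the denominator vanishes, and 0 if both do or if there is no
   equilibrium (the infimum is then +oo).  The supremum and infimum range over
   finitely many values, since there are finitely many allocations. *)
Definition anarchy_ratio : \bar R :=
  (ereal_sup [set (liquid_welfare Y)%:E | Y in is_allocation]%classic /
   ereal_inf [set (liquid_welfare (outcome b))%:E | b in EQ]%classic)%E.

End Game.

(* Pure liquid price of anarchy over the games in the class [C]. *)
Definition LPoA (R : realType) (a : auction) (C : set (game R)) : \bar R :=
  ereal_sup [set anarchy_ratio a G | G in C]%classic.

(* Main.v *)
(* If player [i] deviates to outbid, by a small margin, the highest bid [p_j] on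
   every item of [Y_i] and bids 0 elsewhere, she wins [Y_i]; in both auctions a
   winner pays at most her bid, so she pays little more than the sum of the
   [p_j] over [Y_i].  Equilibrium then gives
   min(v_i(Y_i), c_i) <= min(v_i(X_i), c_i) + \sum_(j in Y_i) p_j.
   Summing over [i], the total of all [p_j] appears, and it is at most
   LW(X) by conservativeness. *)
Require Import Defs.
From mathcomp Require Import all_boot all_order all_algebra.
From mathcomp Require Import all_classical all_reals ereal.
From mathcomp Require Import lra.

Set Implicit Arguments.
Unset Strict Implicit.
Unset Printing Implicit Defensive.

Import Order.TTheory GRing.Theory Num.Theory.
Local Open Scope ring_scope.

Section Payment.
Variables (R : realType) (a : auction) (n : nat) (bj : 'cV[R]_n).
Hypothesis bj_ge0 : forall k, 0 <= bj k 0.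

Lemma payment_ge0 (w : 'I_n) : 0 <= payment a bj w.
Proof.
case: a => //=; set s := sort _ _.
have [sz|/(nth_default 0)->//] := ltnP 1 (size s).
by have := mem_nth 0 sz; rewrite mem_sort => /mapP[k _ ->].
Qed.

Lemma payment_le_bid (w : 'I_n) :
  (forall k, bj k 0 <= bj w 0) -> payment a bj w <= bj w 0.
Proof.
move=> w_max; case: a => //=; set s := sort _ _.
(* A lone bidder pays the default 0; otherwise the second entry is itself some bid, hence at most
   that of [w]. *)
have [sz|/(nth_default 0)->//] := ltnP 1 (size s).
by have := mem_nth 0 sz; rewrite mem_sort => /mapP[k _ ->].
Qed.

End Payment.

Section Equilibrium.
Variables (R : realType) (a : auction) (G : game R).
Local Notation n := (players G).
Local Notation m := (items G).
Implicit Types (b : 'M[R]_(n, m)) (i : 'I_n) (Y : {ffun 'I_n -> {set 'I_m}}).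

(** Read off at the winner, so that it matches the winning bids bounded by conservativeness. *)
Definition highest_bid b (j : 'I_m) : R := b (winner j (col j b)) j.

Lemma le_highest_bid b k j : b k j <= highest_bid b j.
Proof. by have := winner_highest j (col j b) k; rewrite !mxE. Qed.

Lemma highest_bid_outcome b i j :
  j \in outcome b i -> highest_bid b j = b i j.
Proof. by rewrite ffunE inE /highest_bid => /eqP->. Qed.

Lemma outcome_highest b i j k : j \in outcome b i -> b k j <= b i j.
Proof. by move=> /highest_bid_outcome <-; exact: le_highest_bid. Qed.

Lemma total_payment_ge0 b i :
  (forall k j, 0 <= b k j) -> 0 <= total_payment a b i.
Proof.
by move=> b0; apply: sumr_ge0 => j _; apply: payment_ge0 => k; rewrite mxE.
Qed.

Lemma total_payment_le_bids b i : (forall k j, 0 <= b k j) ->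
  total_payment a b i <= \sum_(j in outcome b i) b i j.
Proof.
move=> b0; apply: ler_sum => j jX.
have -> : b i j = col j b i 0 by rewrite mxE.
by apply: payment_le_bid => k; rewrite !mxE //; exact: outcome_highest.
Qed.

Lemma is_allocation_outcome b : is_allocation (outcome b).
Proof.
split=> [i k ik|].
  apply/pred0P => j /=; rewrite !ffunE !inE.
  by apply: contraNF ik => /andP[/eqP-> /eqP->].
apply/setP => j; rewrite inE; apply/bigcupP.
by exists (winner j (col j b)); rewrite // ffunE inE.
Qed.

Lemma sum_allocation Y (F : 'I_m -> R) : is_allocation Y ->
  \sum_i \sum_(j in Y i) F j = \sum_j F j.
Proof.
move=> [Ydisj Ycov]; rewrite [RHS](eq_bigl (mem (\bigcup_i Y i))).
  by rewrite partition_disjoint_bigcup.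
by move=> j; rewrite /= Ycov inE.
Qed.

Lemma liquid_welfare_ge0 Y : 0 <= liquid_welfare Y.
Proof.
by apply: sumr_ge0 => i _; rewrite le_min valuation_ge0 budget_ge0.
Qed.

Lemma sum_highest_bid_le b : conservative b ->
  \sum_j highest_bid b j <= liquid_welfare (outcome b).
Proof.
move=> b_cons; rewrite -(sum_allocation _ (is_allocation_outcome b)).
apply: ler_sum => i _; apply: le_trans (b_cons i).
by rewrite (eq_bigr (b i)) // => j; exact: highest_bid_outcome.
Qed.

Section Overbid.
Variables (b : 'M[R]_(n, m)) (i : 'I_n) (S : {set 'I_m}) (e : R).
Hypotheses (b_ge0 : forall k j, 0 <= b k j) (e_gt0 : 0 < e).

Definition overbid : 'rV[R]_m :=
  \row_j if j \in S then highest_bid b j + e else 0.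

Lemma overbid_ge0 j : 0 <= overbid 0 j.
Proof.
by rewrite mxE; case: ifP => // _; exact: addr_ge0 (b_ge0 _ _) (ltW e_gt0).
Qed.

Lemma deviate_overbid_ge0 k j : 0 <= deviate b i overbid k j.
Proof. by rewrite mxE; case: ifP => // _; exact: overbid_ge0. Qed.

(** Only an inclusion: a bid of 0 may still win items outside [S] through ties. *)
Lemma overbid_wins : S \subset outcome (deviate b i overbid) i.
Proof.
apply/fintype.subsetP => j jS; rewrite ffunE inE.
have := winner_highest j (col j (deviate b i overbid)) i.
set w := winner _ _; rewrite !mxE eqxx jS; case: (w == i) => // bwj.
(* Another winner bids as in [b], so she would exceed the highest bid there by [e]. *)
have := le_trans bwj (le_highest_bid b w j).
by rewrite gerDl leNgt e_gt0.
Qed.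

(** Payments are at most bids, and any item won outside [S] carries bid 0. *)
Lemma total_payment_overbid :
  total_payment a (deviate b i overbid) i <=
  \sum_(j in S) highest_bid b j + e * #|S|%:R.
Proof.
apply: le_trans (total_payment_le_bids _ deviate_overbid_ge0) _.
rewrite mulr_natr -sumr_const -big_split /=.
rewrite [leRHS]big_mkcond [leLHS]big_mkcond /=; apply: ler_sum => j _.
rewrite !mxE eqxx; case: (boolP (j \in S)) => [jS|_]; last by case: ifP.
by rewrite (fintype.subsetP overbid_wins).
Qed.

End Overbid.

Lemma equilibrium_bundle_le b i (S : {set 'I_m}) :
    monotone_valuation (@valuation R G i) -> EQ a b ->
  Num.min (valuation i S) (budget i) <=
  Num.min (valuation i (outcome b i)) (budget i) +
  \sum_(j in S) highest_bid b j.
Proof.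
move=> v_mono [b0 _ b_nash]; rewrite leNgt; apply/negP.
set P := \sum_(j in S) _; set X := outcome b i => lt_dev.
have P0 : 0 <= P by apply: sumr_ge0 => j _; exact: b0.
have vX0 : 0 <= valuation i X by exact: valuation_ge0.
(* Were the budget below the value of [X], [lt_dev] would put budget plus [P] below the budget,
   although [P] is nonnegative. *)
have [ltS ltc] : valuation i X + P < valuation i S /\
                 valuation i X + P < budget i.
  move: lt_dev; rewrite lt_min => /andP[].
  by case: (leP (valuation i X) (budget i)) => _ ? ?; split; lra.
(* The slack [d] serves both affordability and profit: a total margin below [d] keeps the payment
   within budget and the utility above the value of [X]. *)
pose d := Num.min (valuation i S) (budget i) - (valuation i X + P).
have d0 : 0 < d by rewrite subr_gt0 lt_min ltS.
(* The successor makes the total margin strictly less than [d] and allows empty [S]. *)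
pose e := d / #|S|.+1%:R.
have e0 : 0 < e by rewrite divr_gt0.
have eS : e * #|S|%:R < d.
  by rewrite mulrAC ltr_pdivrMr // ltr_pM2l // ltr_nat.
have dS : d <= valuation i S - (valuation i X + P).
  by rewrite lerD2r ge_min lexx.
have dc : d <= budget i - (valuation i X + P).
  by rewrite lerD2r ge_min lexx orbT.
have := b_nash i (overbid b S e) (overbid_ge0 S b0 e0).
have := total_payment_overbid i S b0 e0.
have := v_mono _ _ (overbid_wins b i S e0).
rewrite /utility -/P; set b' := deviate _ _ _ => vS pay.
have -> : total_payment a b' i <= budget i by lra.
have pay0 := total_payment_ge0 i b0.
(* Over budget, the equilibrium utility is -oo, below the finite utility of the deviation. *)
case: ifP => _; last by rewrite leeNy_eq.
by rewrite lee_fin -/X => ?; lra.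
Qed.

Lemma liquid_welfare_le_equilibrium b Y :
    (forall i, monotone_valuation (@valuation R G i)) ->
    EQ a b -> is_allocation Y ->
  liquid_welfare Y <= 2 * liquid_welfare (outcome b).
Proof.
move=> v_mono bEQ Yalloc; have [_ b_cons _] := bEQ.
rewrite mulr_natl mulr2n.
apply: le_trans (lerD (lexx _) (sum_highest_bid_le b_cons)).
rewrite -(sum_allocation _ Yalloc) -big_split /=.
by apply: ler_sum => i _; exact: equilibrium_bundle_le.
Qed.

End Equilibrium.

(** Passes from a pointwise bound to the quotient in the price of anarchy, whose denominator may be
    0, or +oo when no equilibrium exists. *)
Lemma ereal_sup_div_inf_le (R : realType) (A B : set (\bar R)) (r : R) :
    0 < r -> (forall y, B y -> 0 <= y)%E ->
    (forall x y, A x -> B y -> x <= r%:E * y)%E ->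
  (ereal_sup A / ereal_inf B <= r%:E)%E.
Proof.
move=> r0 B0 AB.
have supAB : (ereal_sup A <= r%:E * ereal_inf B)%E.
  apply: ge_ereal_sup => x Ax; rewrite -lee_pdivrMl //.
  by apply/ereal_infP => y By; rewrite lee_pdivrMl //; exact: AB.
have : (0 <= ereal_inf B)%E by apply/ereal_infP.
case: (ereal_inf B) supAB => [t supt|_ _|//]; last first.
  by rewrite invey mule0 lee_fin ltW.
rewrite lee_fin le_eqVlt => /predU1P[t0|t0].
  (* A zero infimum forces the supremum to be at most 0, so its product with +oo is too. *)
  move: supt; rewrite -t0 mule0 inve0 => sup0; apply: le_trans (_ : 0 <= _)%E.
    by rewrite mule_le0_ge0 // leey.
  by rewrite lee_fin ltW.
by rewrite inver gt_eqF // lee_pdivrMr.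
Qed.

Theorem corollary3 (R : realType) (a : auction) :
  (LPoA a (@subadditive_games R) <= 2%:E)%E /\
  (forall G : game R, subadditive_games G ->
   forall b : 'M[R]_(players G, items G), EQ a b ->
   forall Y : {ffun 'I_(players G) -> {set 'I_(items G)}}, is_allocation Y ->
     liquid_welfare Y <= 2 * liquid_welfare (outcome b)).
Proof.
have bound (G : game R) : subadditive_games G ->
    forall b : 'M[R]_(players G, items G), EQ a b ->
    forall Y : {ffun 'I_(players G) -> {set 'I_(items G)}}, is_allocation Y ->
    liquid_welfare Y <= 2 * liquid_welfare (outcome b).
  move=> GC b bEQ Y Yalloc.
  have v_mono i : monotone_valuation (@valuation R G i) by have [] := GC i.
  exact: (liquid_welfare_le_equilibrium v_mono bEQ Yalloc).
split=> //; apply: ge_ereal_sup => _ [G GC <-].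
apply: ereal_sup_div_inf_le => // [_ [b _ <-]|_ _ [Y Yalloc <-] [b bEQ <-]].
  by rewrite lee_fin liquid_welfare_ge0.
by rewrite -EFinM lee_fin; exact: bound.
Qed.
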